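(* Assume that $\mu_1=\mu_2\in\mathcal P_{ac}(\mathbb R^d)$. Then the distribution of the rank-based kernel two-sample statistic $\gamma^{\nu,J}_{m,n}$ is universal, that is, it does not depend on the common distribution $\mu_1=\mu_2$, for all $m,n\ge1$.
   Context: $\mathcal P_{ac}(\mathbb R^d)$ is the set of Lebesgue absolutely continuous probability measures on $\mathbb R^d$. $X_1,\dots,X_m$ are i.i.d. $\mu_1$ and $Y_1,\dots,Y_n$ are i.i.d. $\mu_2$, the two samples being independent; $N=m+n$ and $Z_1,\dots,Z_N$ enumerates the pooled sample. $\{h_1^d,\dots,h_N^d\}\subset\mathbb R^d$ is a fixed set of $N$ vectors. Empirical ranks: $\widehat\sigma\in\arg\min_{\sigma\in S_N}\sum_{i=1}^N\|Z_i-h^d_{\sigma_i}\|^2$, where $S_N$ is the set of permutations of $\{1,\dots,N\}$, and $\widehat R_{m,n}(Z_i):=h^d_{\widehat\sigma_i}$. $\nu\in\mathcal P_{ac}(\mathbb R^d)$ is a reference distribution, $J:\mathbb R^d\to\mathbb R^d$ a score function (injective, continuous Lebesgue a.e.), and $K:\mathbb R^d\times\mathbb R^d\to\mathbb R$ a symmetric, non-negative definite kernel, continuous Lebesgue a.e. on $\mathbb R^d\times\mathbb R^d$. Writing $\widehat x_i=J(\widehat R_{m,n}(X_i))$, $\widehat y_j=J(\widehat R_{m,n}(Y_j))$, $$\gamma^{\nu,J}_{m,n}:=\frac{mn}{m+n}\Big[\frac1{m(m-1)}\sum_{1\le i\ne j\le m}K(\widehat x_i,\widehat x_j)+\frac1{n(n-1)}\sum_{1\le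 i\ne j\le n}K(\widehat y_i,\widehat y_j)-\frac2{mn}\sum_{i=1}^m\sum_{j=1}^nK(\widehat x_i,\widehat y_j)\Big]$$ (an empty sum, with its factor, is $0$ when a sample has size one). *)

(* Defs.v *)
From HB Require Import structures.
From mathcomp Require Import all_boot all_order all_algebra perm.
From mathcomp Require Import all_classical all_reals all_analysis.

Set Implicit Arguments.
Unset Strict Implicit.
Unset Printing Implicit Defensive.

Import Order.TTheory GRing.Theory Num.Theory.
Import numFieldNormedType.Exports.

Local Open Scope classical_set_scope.
Local Open Scope ring_scope.

(* R^d is 'rV[R]_d. Its topology is the product topology and its sigma-algebra
   is the product one, generated by the coordinates; since R is second
   countable, the latter is the Borel sigma-algebra of the former. *)
Section measurable_rV.
Context {R : realType} {d : nat}.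

Let coor : 'I_d -> 'rV[R]_d -> measurableTypeR R := fun i x => x ord0 i.

Let rV_set0 : g_sigma_preimage coor set0.
Proof. exact: sigma_algebra0. Qed.

Let rV_setC A : g_sigma_preimage coor A -> g_sigma_preimage coor (~` A).
Proof. exact: sigma_algebraC. Qed.

Let rV_bigcup (F : _^nat) : (forall i, g_sigma_preimage coor (F i)) ->
  g_sigma_preimage coor (\bigcup_i (F i)).
Proof. exact: sigma_algebra_bigcup. Qed.

HB.instance Definition _ := @isMeasurable.Build default_measure_display
  'rV[R]_d (g_sigma_preimage coor) rV_set0 rV_setC rV_bigcup.

End measurable_rV.

Lemma measurable_coor {R : realType} {d : nat} (i : 'I_d) :
  measurable_fun [set: 'rV[R]_d] (fun x : 'rV[R]_d => x ord0 i : measurableTypeR R).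
Proof.
move=> _ Y mY; rewrite setTI; apply: sub_sigma_algebra => /=.
rewrite -bigcup_seq/=; exists i => /=; first by rewrite mem_index_enum.
by exists Y => //; rewrite setTI.
Qed.

Lemma measurable_fun_rV {R : realType} {d : nat} disp (T : measurableType disp)
    (f : T -> 'rV[R]_d) :
  (forall i, measurable_fun [set: T]
     (fun t => f t ord0 i : measurableTypeR R)) ->
  measurable_fun [set: T] f.
Proof.
move=> mf _ Y mY; rewrite setTI.
suff: preimage_set_system setT f measurable `<=` measurable.
  by apply; exists Y => //; rewrite setTI.
have -> : preimage_set_system setT f (@measurable _ 'rV[R]_d) =
    g_sigma_preimage (fun i t => f t ord0 i : measurableTypeR R).
  by rewrite -g_sigma_preimage_comp.
apply: smallest_sub; first exact: sigma_algebra_measurable.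
rewrite -bigcup_seq; apply: bigcup_sub => i _ A [B mB <-]; exact: mf.
Qed.

Definition consrV {R : realType} {d : nat}
  (p : measurableTypeR R * 'rV[R]_d) : 'rV[R]_d.+1 :=
  row_mx (p.1%:M : 'rV[R]_1) p.2.

Definition unconsrV {R : realType} {d : nat} (x : 'rV[R]_d.+1) :
    measurableTypeR R * 'rV[R]_d :=
  (x ord0 ord0, \row_i x ord0 (lift ord0 i)).

Lemma consrVK {R : realType} {d : nat} : cancel (@consrV R d) unconsrV.
Proof.
move=> [a v]; congr pair => /=.
  transitivity (row_mx (a%:M : 'rV[R]_1) v ord0 (lshift d ord0)).
    by rewrite /consrV /=; congr (row_mx _ _ _); exact: ord_inj.
  by rewrite row_mxEl mxE eqxx mulr1n.
apply/rowP => i; rewrite mxE.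
transitivity (row_mx (a%:M : 'rV[R]_1) v ord0 (rshift 1 i)).
  by rewrite /consrV /=; congr (row_mx _ _ _); exact: ord_inj.
by rewrite row_mxEr.
Qed.

Lemma measurable_consrV {R : realType} {d : nat} :
  measurable_fun [set: _] (@consrV R d).
Proof.
apply: measurable_fun_rV => i.
have [j|j] := split_ordP (i : 'I_(1 + d)) => ij.
  rewrite (_ : (fun _ => _) = fst); first exact: measurable_fst.
  apply/funext => p; rewrite -[RHS](mulr1n p.1) /consrV.
  transitivity ((p.1%:M : 'rV[R]_1) ord0 j); last by rewrite mxE (ord1 j) eqxx.
  by apply: etrans (row_mxEl _ p.2 ord0 j); rewrite ij.
rewrite (_ : (fun _ => _) = (fun v : 'rV[R]_d => v ord0 j) \o snd).
  exact: (measurableT_comp (measurable_coor j) measurable_snd).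
apply/funext => p; by apply: etrans (row_mxEr (p.1%:M : 'rV[R]_1) p.2 ord0 j); rewrite /= ij.
Qed.

Lemma measurable_unconsrV {R : realType} {d : nat} :
  measurable_fun [set: _] (@unconsrV R d).
Proof.
apply/measurable_fun_pair; first exact: measurable_coor.
apply: measurable_fun_rV => i /=.
under eq_fun do rewrite mxE.
exact: measurable_coor.
Qed.

Section lebesgue_step.
Context {R : realType} {d : nat}.
Variable m : {sigma_finite_measure set 'rV[R]_d -> \bar R}.

Definition lebesgue_step : set 'rV[R]_d.+1 -> \bar R :=
  pushforward (lebesgue_measure \x m)%E consrV.

Let lebesgue_step0 : lebesgue_step set0 = 0%E.
Proof. by rewrite /lebesgue_step /pushforward preimage_set0 measure0. Qed.

Let lebesgue_step_ge0 A : (0 <= lebesgue_step A)%E.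
Proof. exact: (measure_ge0 (lebesgue_measure \x m)%E). Qed.

Let lebesgue_step_sigma_additive : semi_sigma_additive lebesgue_step.
Proof.
exact: (@measure_semi_sigma_additive _ _ _
  (measure_function_pushforward__canonical__measure_function_Measure
    (lebesgue_measure \x m)%E measurable_consrV)).
Qed.

HB.instance Definition _ := isMeasure.Build _ _ _ lebesgue_step
  lebesgue_step0 lebesgue_step_ge0 lebesgue_step_sigma_additive.

Let lebesgue_step_sigma_finite : sigma_finite setT lebesgue_step.
Proof.
have /sigma_finiteP[F [TF ndF Foo]] := sigma_finiteT (@lebesgue_measure R).
have /sigma_finiteP[G [TG ndG Goo]] := sigma_finiteT m.
exists (fun k => unconsrV @^-1` (F k `*` G k)).
  rewrite -preimage_bigcup (_ : \bigcup_k _ = setT) ?preimage_setT//.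
  rewrite -setXTT TF TG predeqE => -[x y]; split.
    by move=> [n _ []/= ? ?]; split; exists n.
  move=> [/= [n _ Fnx] [k _ Gky]]; exists (maxn n k) => //; split.
  - by move: x Fnx; exact/subsetPset/ndF/leq_maxl.
  - by move: y Gky; exact/subsetPset/ndG/leq_maxr.
move=> k; have [mF Fk] := Foo k; have [mG Gk] := Goo k; split.
  by rewrite -[X in measurable X]setTI; apply: measurable_unconsrV => //;
    exact: measurableX.
rewrite /lebesgue_step /pushforward -comp_preimage (_ : _ \o _ = id).
  by rewrite preimage_id product_measure1E// lte_mul_pinfty// ge0_fin_numE.
by apply/funext => p; exact: consrVK.
Qed.

HB.instance Definition _ := Measure_isSigmaFinite.Build _ _ _ lebesgue_step
  lebesgue_step_sigma_finite.

End lebesgue_step.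

(* Lebesgue measure on R^d as the d-fold product measure, R^(d+1) being
   identified with R * R^d. *)
Fixpoint lebesgue_rV {R : realType} (d : nat) :
    {sigma_finite_measure set 'rV[R]_d -> \bar R} :=
  if d is d'.+1 then lebesgue_step (lebesgue_rV d') else \d_(0 : 'rV[R]_0).

Lemma lebesgue_rV_box {R : realType} (d : nat)
    (A : 'I_d -> set (measurableTypeR R)) :
  (forall i, measurable (A i)) ->
  lebesgue_rV d [set x : 'rV[R]_d | forall i, A i (x ord0 i)] =
  (\prod_(i < d) lebesgue_measure (A i))%E.
Proof.
elim: d A => [A _|d IHd A mA].
  rewrite big_ord0 /= diracE mem_set//; by case.
rewrite big_ord_recl -IHd//= -product_measure1E//; last first.
  rewrite (_ : mkset _ =
      \bigcap_(i in [set: 'I_d]) ((fun x : 'rV[R]_d => x ord0 i) @^-1` A (lift ord0 i))).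
    apply: fin_bigcap_measurable => // i _.
    by rewrite -[X in measurable X]setTI; exact: measurable_coor.
  by apply/seteqP; split => [x Ax i _|x Ax i]; [exact: Ax|exact: (Ax i)].
rewrite /lebesgue_step /pushforward; congr product_measure1.
apply/seteqP; split => p; rewrite -[X in (_ `*` _) X](consrVK p)/=.
  by move=> Ap; split=> [|i]; [exact: Ap|rewrite mxE; exact: Ap].
move=> [A0 Ap] i; have [j ->|->//] := unliftP ord0 i.
by have := Ap j; rewrite mxE.
Qed.

Definition abs_continuous {R : realType} {d : nat}
    (mu : probability 'rV[R]_d R) : Prop :=
  mu `<< lebesgue_rV d.

Definition ae_continuous {R : realType} {d : nat} {T : topologicalType}
    (f : 'rV[R]_d -> T) : Prop :=
  {ae lebesgue_rV d, forall x, {for x, continuous f}}.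

Definition ae_continuous2 {R : realType} {d : nat}
    (K : 'rV[R]_d -> 'rV[R]_d -> R) : Prop :=
  {ae (lebesgue_rV d \x lebesgue_rV d)%E,
    forall p, {for p, continuous (fun q => K q.1 q.2)}}.

Definition symmetric_kernel {T R : Type} (K : T -> T -> R) : Prop :=
  forall x y, K x y = K y x.

Definition nonneg_definite {T : Type} {R : realType} (K : T -> T -> R) : Prop :=
  forall (k : nat) (x : 'I_k -> T) (c : 'I_k -> R),
    0 <= \sum_(i < k) \sum_(j < k) c i * c j * K (x i) (x j).

Section independence.
Context {R : realType} {disp : measure_display} {Omega : measurableType disp}.
Variable P : probability Omega R.

Definition mutually_independent {disp1 : measure_display}
    {T : measurableType disp1} {I : finType} (X : I -> Omega -> T) : Prop :=
  forall (S : {set I}) (A : I -> set T), (forall i, measurable (A i)) ->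
    P (\bigcap_(i in [set` S]) (X i @^-1` A i)) =
    (\prod_(i in S) P (X i @^-1` A i))%E.

Definition independent {disp1 disp2 : measure_display}
    {T1 : measurableType disp1} {T2 : measurableType disp2}
    (U : Omega -> T1) (V : Omega -> T2) : Prop :=
  forall (A : set T1) (B : set T2), measurable A -> measurable B ->
    P (U @^-1` A `&` V @^-1` B) = (P (U @^-1` A) * P (V @^-1` B))%E.

Definition iid {disp1 : measure_display} {T : measurableType disp1}
    {I : finType} (X : I -> {RV P >-> T}) (mu : probability T R) : Prop :=
  mutually_independent (fun i => X i : Omega -> T) /\
  forall i (A : set T), measurable A -> distribution P (X i) A = mu A.

Definition sample_tuple {disp1 : measure_display} {T : measurableType disp1}
    {m : nat} (X : 'I_m -> {RV P >-> T}) (w : Omega) : m.-tuple T :=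
  [tuple X i w | i < m].

Definition independent_samples {disp1 : measure_display}
    {T : measurableType disp1} {m n : nat}
    (X : 'I_m -> {RV P >-> T}) (Y : 'I_n -> {RV P >-> T}) : Prop :=
  independent (sample_tuple X) (sample_tuple Y).

End independence.

(* The pooled sample, enumerated as X_1, ..., X_m, Y_1, ..., Y_n. *)
Definition pooled {T : Type} {m n : nat} (x : 'I_m -> T) (y : 'I_n -> T)
    (i : 'I_(m + n)) : T :=
  match fintype.split i with inl j => x j | inr j => y j end.

(* The norm that the library puts on 'rV is the sup norm. *)
Definition euclidean_norm {R : realType} {d : nat} (x : 'rV[R]_d) : R :=
  Num.sqrt (\sum_(k < d) x ord0 k ^+ 2).

Definition assignment_cost {R : realType} {d N : nat} (h z : 'I_N -> 'rV[R]_d)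
    (s : {perm 'I_N}) : R :=
  \sum_(i < N) euclidean_norm (z i - h (s i)) ^+ 2.

Definition optimal_assignment {R : realType} {d N : nat}
    (h z : 'I_N -> 'rV[R]_d) (s : {perm 'I_N}) : Prop :=
  forall t : {perm 'I_N}, assignment_cost h z s <= assignment_cost h z t.

(* If m = 1 the first sum is empty and its factor is 0^-1 = 0, likewise for
   n = 1. *)
Definition kernel_two_sample {R : realType} {T : Type} (K : T -> T -> R)
    {m n : nat} (x : 'I_m -> T) (y : 'I_n -> T) : R :=
  (m * n)%:R / (m + n)%:R *
  ((m * (m - 1))%:R^-1 * \sum_(i < m) \sum_(j < m | i != j) K (x i) (x j)
   + (n * (n - 1))%:R^-1 * \sum_(i < n) \sum_(j < n | i != j) K (y i) (y j)
   - 2 / (m * n)%:R * \sum_(i < m) \sum_(j < n) K (x i) (y j)).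

(* gamma^{nu,J}_{m,n} as a function of the permutation realizing the empirical
   ranks; nu enters only through the choice of J and h. *)
Definition rank_statistic {R : realType} {d m n : nat}
    (h : 'I_(m + n) -> 'rV[R]_d) (J : 'rV[R]_d -> 'rV[R]_d)
    (K : 'rV[R]_d -> 'rV[R]_d -> R) (s : {perm 'I_(m + n)}) : R :=
  kernel_two_sample K (fun i : 'I_m => J (h (s (lshift n i))))
                      (fun j : 'I_n => J (h (s (rshift m j)))).

(* Main.v *)
(** The pooled sample has law mu^N, which is invariant under permutations of
    the sample; hence all permutations are equally likely to be optimal. A tie
    between two assignments that rank the sample differently is an affine
    equation in the sample, hence null since mu is absolutely continuous. So
    almost surely the optimal assignments are {t | h o t = h o s} for any
    optimal s, a coset of the stabilizer of h, on which the statistic is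
    constant. Counting each outcome with the constant size of that coset, the
    statistic is distributed as its value at a uniformly random permutation. *)
From HB Require Import structures.
Require Import Defs.
From mathcomp Require Import all_boot all_order all_algebra perm.
From mathcomp Require Import all_classical all_reals all_analysis.
From mathcomp Require Import measurable_realfun ring.

Set Implicit Arguments.
Unset Strict Implicit.
Unset Printing Implicit Defensive.

Import Order.TTheory GRing.Theory Num.Theory.
Import numFieldNormedType.Exports.

Local Open Scope classical_set_scope.
Local Open Scope ring_scope.

(** * The image of the uniform law on a finite type *)

Section uniform_image.
Context {R : realType} {disp : measure_display} {T : measurableType disp}.
Variables (I : finType) (x0 : I) (f : I -> T).

(** [msum] runs over an initial segment of the naturals, hence the enumeration of [I]. The element
    [x0] is the default of [nth], and it makes the total mass 1 by showing that [I] is nonempty. *)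
Definition uniform_image : set T -> \bar R :=
  mscale (#|I|%:R^-1)%:nng
    (msum (fun k => \d_(f (nth x0 (enum I) k))) #|I|).

HB.instance Definition _ := Measure.on uniform_image.

Lemma uniform_imageE B :
  uniform_image B = (#|I|%:R^-1%:E * \sum_(i : I) \d_(f i) B)%E.
Proof.
rewrite /uniform_image /mscale/= /msum; congr (_ * _)%E.
by rewrite -[RHS]big_enum/= (big_nth x0) big_mkord -cardE.
Qed.

Let uniform_image_setT : uniform_image setT = 1%E.
Proof.
rewrite uniform_imageE (eq_bigr (fun=> 1%:E)) => [|i _]; last first.
  by rewrite diracT.
rewrite sumEFin sumr_const -EFinM mulVf// pnatr_eq0 -lt0n.
by apply/card_gt0P; exists x0.
Qed.

HB.instance Definition _ :=
  Measure_isProbability.Build _ _ _ uniform_image uniform_image_setT.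

End uniform_image.

(** * Measures on tuples are determined by boxes *)

Section tuple_measure.
Context {R : realType} {disp : measure_display} {T : measurableType disp}.
Variable n : nat.

Definition tuple_box (A : 'I_n -> set T) : set (n.-tuple T) :=
  [set t | forall i, A i (tnth t i)].

Lemma measurable_tuple_box (A : 'I_n -> set T) :
  (forall i, measurable (A i)) -> measurable (tuple_box A).
Proof.
move=> mA; rewrite (_ : tuple_box A =
    \bigcap_(i in [set: 'I_n]) ((fun t => tnth t i) @^-1` A i)).
  apply: fin_bigcap_measurable => // i _; rewrite -[X in measurable X]setTI.
  exact: measurable_tnth.
by apply/seteqP; split => [t At i _|t At i]; [exact: At|exact: (At i)].
Qed.

(** Boxes form a pi-system that contains the whole space and generates the sigma-algebra of tuples,
    so the uniqueness theorem for measures applies. *)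
Lemma tuple_measure_unique (m1 m2 : {measure set (n.-tuple T) -> \bar R}) :
  (m1 setT < +oo)%E ->
  (forall A, (forall i, measurable (A i)) ->
    m1 (tuple_box A) = m2 (tuple_box A)) ->
  forall E, measurable E -> m1 E = m2 E.
Proof.
move=> m1oo m12 E mE.
pose G := [set B | exists2 A : 'I_n -> set T,
  (forall i, measurable (A i)) & B = tuple_box A].
apply: (measure_unique G (fun=> setT)) => //.
- apply/seteqP; split.
    apply: smallest_sub; first exact: smallest_sigma_algebra.
    rewrite -bigcup_seq; apply: bigcup_sub => i _ _ [B mB <-].
    (* A cylinder over coordinate [i] is the box whose other sides are full. *)
    apply: sub_sigma_algebra; exists (fun j => if j == i then B else setT).
      by move=> j; case: ifP.
    rewrite setTI; apply/seteqP; split => [t Bt j|t /(_ i)].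
      by case: eqP => [->|].
    by rewrite eqxx.
  apply: smallest_sub; first exact: sigma_algebra_measurable.
  by move=> _ [A mA ->]; exact: measurable_tuple_box.
- move=> _ _ [A mA ->] [B mB ->]; exists (fun i => A i `&` B i).
    by move=> i; exact: measurableI.
  apply/seteqP; split => [t [At Bt] i|t ABt].
    by split; [exact: At|exact: Bt].
  by split => i; have [] := ABt i.
- by move=> _; exists (fun=> setT) => //; apply/seteqP; split.
- by rewrite bigcup_const.
- by move=> _ [A mA ->]; exact: m12.
Qed.

End tuple_measure.

(** * Product laws: permuting and resampling coordinates *)

Section power_law.
Context {R : realType} {disp : measure_display} {T : measurableType disp}.
Variables (n : nat) (mu : probability T R) (Q : probability (n.-tuple T) R).
Hypothesis QE : forall A, (forall i, measurable (A i)) ->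
  Q (tuple_box A) = (\prod_(i < n) mu (A i))%E.

(** [Q] is specified by its values on boxes alone; by uniqueness a law that agrees with it there is
    [Q], so both invariances below reduce to boxes. *)
Lemma power_law_pushforward d' (S : measurableType d')
    (nu : {measure set S -> \bar R}) (f : S -> n.-tuple T) :
  measurable_fun setT f ->
  (forall A, (forall i, measurable (A i)) ->
    nu (f @^-1` tuple_box A) = (\prod_(i < n) mu (A i))%E) ->
  forall E, measurable E -> nu (f @^-1` E) = Q E.
Proof.
move=> mf nuE E mE; apply/esym.
pose m2 :=
  measure_function_pushforward__canonical__measure_function_Measure nu mf.
apply: (@tuple_measure_unique _ _ _ _ Q m2) => // [|A mA].
  by have := probability_setT Q => /= ->; rewrite ltry.
by apply: etrans (QE mA) _; rewrite -nuE.
Qed.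

Definition perm_tuple (s : {perm 'I_n}) (t : n.-tuple T) : n.-tuple T :=
  [tuple tnth t (s i) | i < n].

Lemma measurable_perm_tuple s : measurable_fun setT (perm_tuple s).
Proof.
apply/measurable_fun_tnthP => i; rewrite (_ : _ \o _ = (@tnth n T)^~ (s i)).
  exact: measurable_tnth.
by apply/funext => t /=; rewrite tnth_mktuple.
Qed.

Lemma power_law_perm (s : {perm 'I_n}) E :
  measurable E -> Q (perm_tuple s @^-1` E) = Q E.
Proof.
apply: power_law_pushforward; first exact: measurable_perm_tuple.
(* The condition on coordinate [s i] is [A i], so the side at [j] is indexed by the preimage of [j]
   under [s]. *)
move=> A mA; rewrite (_ : _ @^-1` _ = tuple_box (fun i => A ((s^-1)%g i))).
  rewrite [LHS]QE// (reindex_inj (@perm_inj _ s))/=.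
  by apply: eq_bigr => i _; rewrite permK.
apply/seteqP; split => t At i.
  by have := At ((s^-1)%g i); rewrite tnth_mktuple permKV.
by rewrite tnth_mktuple; have := At (s i); rewrite permK.
Qed.

Definition set_tnth (i : 'I_n) (p : n.-tuple T * T) : n.-tuple T :=
  [tuple if j == i then p.2 else tnth p.1 j | j < n].

Lemma measurable_set_tnth i : measurable_fun setT (set_tnth i).
Proof.
apply/measurable_fun_tnthP => j; have [->|ji] := eqVneq j i.
  rewrite (_ : _ \o _ = snd); first exact: measurable_snd.
  by apply/funext => p /=; rewrite tnth_mktuple eqxx.
rewrite (_ : _ \o _ = (@tnth n T)^~ j \o fst).
  exact: (measurableT_comp (measurable_tnth j) measurable_fst).
by apply/funext => p /=; rewrite tnth_mktuple (negbTE ji).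
Qed.

(** This gives access to Fubini in coordinate [i] with the others frozen, without splitting the
    tuple space into factors. It holds because the discarded coordinate is left unconstrained, which
    contributes a factor 1. *)
Lemma power_law_resample i E :
  measurable E -> Q E = (Q \x mu)%E (set_tnth i @^-1` E).
Proof.
move=> mE; apply/esym.
apply: power_law_pushforward mE; first exact: measurable_set_tnth.
move=> A mA.
pose A' j := if j == i then setT else A j.
have mA' j : measurable (A' j) by rewrite /A'; case: ifP.
rewrite (_ : _ @^-1` _ = tuple_box A' `*` A i).
  transitivity (Q (tuple_box A') * mu (A i))%E.
    by apply: product_measure1E => //; exact: measurable_tuple_box.
  rewrite QE// (bigD1 i)//= [in RHS](bigD1 i)//= {1}/A' eqxx.
  rewrite probability_setT mul1e muleC; congr (_ * _)%E.
  by apply: eq_bigr => j /negbTE ji; rewrite /A' ji.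
apply/seteqP; split => [[t x] At|[t x] [/= At Ax] j].
  split => [j|] /=.
    by have := At j; rewrite tnth_mktuple /A'/=; case: ifP.
  by have := At i; rewrite tnth_mktuple eqxx.
by rewrite tnth_mktuple/=; have := At j; rewrite /A'; case: eqP => // ->.
Qed.

End power_law.

(** * Affine hyperplanes are null sets *)

Section hyperplane.
Context {R : realType}.

Definition linear_form {d : nat} (c x : 'rV[R]_d) : R :=
  \sum_(k < d) x ord0 k * c ord0 k.

Lemma measurable_linear_form {d : nat} (c : 'rV[R]_d) :
  measurable_fun setT (linear_form c : _ -> measurableTypeR R).
Proof.
apply: measurable_sum => k; apply: measurable_funM => //.
exact: measurable_coor.
Qed.

Lemma measurable_hyperplane {d : nat} (c : 'rV[R]_d) (u : R) :
  measurable [set x | linear_form c x = u].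
Proof.
rewrite -[X in measurable X]setTI.
exact: (@measurable_linear_form _ c measurableT _ (measurable_set1 u)).
Qed.

Lemma linear_form_consrV {d : nat} (c : 'rV[R]_d.+1)
    (p : measurableTypeR R * 'rV[R]_d) :
  linear_form c (consrV p) =
  p.1 * c ord0 ord0 + linear_form (unconsrV c).2 p.2.
Proof.
have pE : unconsrV (consrV p) = p := consrVK p.
(* The two occurrences of [p] on the right become [unconsrV (consrV p)], so that both sides read
   coordinates of the same row. *)
rewrite /linear_form big_ord_recl -{3 4}pE /=; congr (_ + _).
by apply: eq_bigr => k _; rewrite !mxE.
Qed.

(** Induction on the dimension, by Fubini. If [c] has a nonzero tail, fixing the first coordinate
    leaves a hyperplane one dimension lower. Otherwise the set is a point times the whole space. *)
Lemma lebesgue_rV_hyperplane {d : nat} (c : 'rV[R]_d) (u : R) :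
  c != 0 -> lebesgue_rV d [set x | linear_form c x = u] = 0%E.
Proof.
elim: d c u => [c u|d IHd c u c_neq0]; first by rewrite thinmx0 eqxx.
rewrite /= /lebesgue_step /pushforward.
rewrite (_ : _ @^-1` _ = [set p : measurableTypeR R * 'rV[R]_d |
    p.1 * c ord0 ord0 + linear_form (unconsrV c).2 p.2 = u]); last first.
  by apply/seteqP; split => p /=; rewrite linear_form_consrV.
have [tc0|tc_neq0] := eqVneq (unconsrV c).2 0; last first.
  apply: integral0_eq => a _ /=.
  rewrite -[RHS](IHd _ (u - a * c ord0 ord0) tc_neq0).
  congr (lebesgue_rV d _); rewrite xsectionE.
  apply/seteqP; split => v /= cv; first by rewrite -cv addrC addKr.
  by rewrite cv addrC subrK.
have hc_neq0 : c ord0 ord0 != 0.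
  apply: contra c_neq0 => /eqP c0; apply/eqP/rowP => k; rewrite mxE.
  have [j ->|->//] := unliftP ord0 k.
  by have /rowP/(_ j) := tc0; rewrite !mxE.
pose r := u / c ord0 ord0.
rewrite (_ : mkset _ = [set r] `*` setT).
  transitivity (lebesgue_measure [set r] * lebesgue_rV d setT)%E.
    exact: product_measure1E.
  (* The second factor may be infinite; the convention that 0 times infinity is 0 applies. *)
  by rewrite lebesgue_measure_set1 mul0e.
have form0 v : linear_form (unconsrV c).2 v = 0.
  by rewrite tc0 /linear_form big1// => k _; rewrite mxE mulr0.
apply/seteqP; split => [[a v] /=|[a v] [/= -> _]]; rewrite form0 addr0.
  by rewrite /r => <-; split => //=; rewrite mulfK.
by rewrite /r divfK.
Qed.

Lemma abs_continuous_hyperplane {d : nat} (mu : probability 'rV[R]_d R)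
    (c : 'rV[R]_d) (u : R) :
  abs_continuous mu -> c != 0 -> mu [set x | linear_form c x = u] = 0%E.
Proof.
move=> /null_content_dominatesP mu_ac c_neq0.
apply: mu_ac; first exact: measurable_hyperplane.
exact: lebesgue_rV_hyperplane.
Qed.

Lemma measurable_tuple_hyperplane {d n : nat} (c : 'I_n -> 'rV[R]_d) (u : R) :
  measurable [set t : n.-tuple 'rV[R]_d |
    \sum_(j < n) linear_form (c j) (tnth t j) = u].
Proof.
rewrite -[X in measurable X]setTI.
have mform : measurable_fun setT (fun t : n.-tuple 'rV[R]_d =>
    \sum_(j < n) linear_form (c j) (tnth t j) : measurableTypeR R).
  apply: measurable_sum => j.
  exact: (measurableT_comp (measurable_linear_form (c j)) (measurable_tnth j)).
exact: (mform measurableT _ (measurable_set1 u)).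
Qed.

(** Once coordinate [i] is resampled and the others are fixed, the equation describes a hyperplane
    with normal [c i], which is [mu]-null; Fubini concludes. *)
Lemma power_law_hyperplane {d n : nat} (mu : probability 'rV[R]_d R)
    (Q : probability (n.-tuple 'rV[R]_d) R) :
  abs_continuous mu ->
  (forall A, (forall i, measurable (A i)) ->
    Q (tuple_box A) = (\prod_(i < n) mu (A i))%E) ->
  forall (c : 'I_n -> 'rV[R]_d) (u : R) (i : 'I_n), c i != 0 ->
  Q [set t | \sum_(j < n) linear_form (c j) (tnth t j) = u] = 0%E.
Proof.
move=> mu_ac QE c u i ci_neq0.
rewrite (power_law_resample QE i); last exact: measurable_tuple_hyperplane.
apply: integral0_eq => t _ /=.
rewrite -[RHS](abs_continuous_hyperplane
  (u - \sum_(j < n | j != i) linear_form (c j) (tnth t j)) mu_ac ci_neq0).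
congr (mu _); rewrite xsectionE.
have formE x : \sum_(j < n) linear_form (c j) (tnth (set_tnth i (t, x)) j) =
    linear_form (c i) x + \sum_(j < n | j != i) linear_form (c j) (tnth t j).
  rewrite (bigD1 i)//= tnth_mktuple eqxx; congr (_ + _).
  by apply: eq_bigr => j /negbTE ji; rewrite tnth_mktuple ji.
apply/seteqP; split => x /=; rewrite formE => cx.
  by rewrite -cx addrK.
by rewrite cx subrK.
Qed.

End hyperplane.

(** * Optimal assignments and their multiplicity *)

Section assignment.
Context {R : realType} {d N : nat}.
Variable h : 'I_N -> 'rV[R]_d.
Implicit Types (z : N.-tuple 'rV[R]_d) (s t : {perm 'I_N}).

Lemma sqr_euclidean_norm (x : 'rV[R]_d) :
  euclidean_norm x ^+ 2 = \sum_(k < d) x ord0 k ^+ 2.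
Proof. by rewrite sqr_sqrtr// sumr_ge0// => k _; exact: sqr_ge0. Qed.

Lemma eq_assignment_cost (z : 'I_N -> 'rV[R]_d) s t :
  (forall i, h (s i) = h (t i)) ->
  assignment_cost h z s = assignment_cost h z t.
Proof. by move=> st; apply: eq_bigr => i _; rewrite st. Qed.

Lemma assignment_cost_perm z s t :
  assignment_cost h (tnth (perm_tuple t z)) s =
  assignment_cost h (tnth z) (t^-1 * s)%g.
Proof.
rewrite /assignment_cost [RHS](reindex_inj (@perm_inj _ t))/=.
by apply: eq_bigr => i _; rewrite tnth_mktuple permM permK.
Qed.

(** Relabelling the sample by [s] multiplies every competitor on the left by the inverse of [s],
    which permutes the competitors and sends [s] to the identity. *)
Lemma optimal_assignment_perm z s :
  optimal_assignment h (tnth (perm_tuple s z)) s <->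
  optimal_assignment h (tnth z) 1%g.
Proof.
split => opt t.
  by have := opt (s * t)%g; rewrite !assignment_cost_perm mulVg mulKg.
by rewrite !assignment_cost_perm mulVg; exact: opt.
Qed.

Lemma measurable_assignment_cost s :
  measurable_fun setT
    (fun z => assignment_cost h (tnth z) s : measurableTypeR R).
Proof.
apply: measurable_sum => i.
rewrite (_ : (fun z => _) = fun z =>
    \sum_(k < d) ((tnth z i - h (s i)) ord0 k) ^+ 2); last first.
  by apply/funext => z; rewrite sqr_euclidean_norm.
apply: measurable_sum => k; apply: measurable_funX.
under eq_fun do rewrite !mxE.
apply: measurable_funB => //.
exact: (measurableT_comp (measurable_coor k) (measurable_tnth i)).
Qed.

Lemma measurable_optimal_assignment s :
  measurable [set z | optimal_assignment h (tnth z) s].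
Proof.
rewrite (_ : mkset _ = \bigcap_(t in [set: {perm 'I_N}]) [set z |
    assignment_cost h (tnth z) s <= assignment_cost h (tnth z) t]).
  apply: fin_bigcap_measurable => [|t _]; first exact: finite_finset.
  rewrite -[X in measurable X]setTI.
  exact: (measurable_fun_ler (measurable_assignment_cost s)
    (measurable_assignment_cost t) measurableT (Y := [set true])).
by apply/seteqP; split => [z zs t _|z zs t]; [exact: zs|exact: (zs t)].
Qed.

(* The quadratic terms in z cancel, so a tie is an affine equation in z. *)
Lemma assignment_tie z s t :
  assignment_cost h (tnth z) s = assignment_cost h (tnth z) t <->
  \sum_(j < N) linear_form (h (t j) - h (s j)) (tnth z j) =
  2^-1 * \sum_(j < N) \sum_(k < d) (h (t j) ord0 k ^+ 2 - h (s j) ord0 k ^+ 2).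
Proof.
set F := \sum_(j < N) linear_form _ _.
set C := \sum_(j < N) \sum_(k < d) (_ - _).
have costB : assignment_cost h (tnth z) s - assignment_cost h (tnth z) t =
    2 * F - C.
  rewrite /assignment_cost /F /C mulr_sumr -!sumrB; apply: eq_bigr => j _.
  rewrite !sqr_euclidean_norm mulr_sumr -!sumrB; apply: eq_bigr => k _.
  by rewrite !mxE; ring.
split => [/eqP|FC].
  by rewrite -subr_eq0 costB subr_eq0 => /eqP <-; rewrite mulKf.
by apply/eqP; rewrite -subr_eq0 costB FC mulVKf// subrr.
Qed.

(** The vectors [h i] may coincide, so an optimal permutation need not be unique even when all
    optimal ones give the same ranks; the stabilizer measures that multiplicity. *)
Definition rank_stabilizer : {set {perm 'I_N}} :=
  [set t : {perm 'I_N} | [forall i, h (t i) == h i]]%SET.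

(** Left multiplication by [s] carries the stabilizer onto the optimal set. Two optimal permutations
    have equal cost, hence the same ranks, and their quotient fixes [h]; conversely a factor that
    fixes [h] leaves the cost unchanged. *)
Lemma card_optimal_assignment z s :
  (forall t1 t2,
    assignment_cost h (tnth z) t1 = assignment_cost h (tnth z) t2 ->
    forall i, h (t1 i) = h (t2 i)) ->
  optimal_assignment h (tnth z) s ->
  #|[set t : {perm 'I_N} | `[< optimal_assignment h (tnth z) t >]]%SET| =
  #|rank_stabilizer|.
Proof.
move=> noties opt; rewrite -[RHS](card_imset _ (mulgI s)).
apply: eq_card => t; rewrite inE; apply/asboolP/imsetP => [topt|[u]].
  have st := noties s t (le_anti (introT andP (conj (opt t) (topt s)))).
  exists (s^-1 * t)%g; last by rewrite mulVKg.
  by rewrite inE; apply/forallP => i; rewrite permM -st permKV.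
rewrite inE => /forallP hu -> v; rewrite (@eq_assignment_cost _ _ s) => [|i].
  exact: opt.
by rewrite permM; apply/eqP.
Qed.

End assignment.

(** * The law of a statistic of the ranks *)

Section rank_law.
Context {R : realType} {d N : nat} (h : 'I_N -> 'rV[R]_d).
Context {disp : measure_display} {Omega : measurableType disp}.
Variables (P : probability Omega R) (Z : {RV P >-> N.-tuple 'rV[R]_d}).
Variable mu : probability 'rV[R]_d R.
Hypothesis mu_ac : abs_continuous mu.
Hypothesis ZE : forall A, (forall i, measurable (A i)) ->
  P (Z @^-1` tuple_box A) = (\prod_(i < N) mu (A i))%E.

(** There are finitely many pairs [s], [t]. When the ranks differ at some [i], a tie is an affine
    equation whose coefficient at [i] is nonzero, hence a null event. *)
Lemma ae_no_assignment_tie :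
  {ae P, forall w, forall s t,
    assignment_cost h (tnth (Z w)) s = assignment_cost h (tnth (Z w)) t ->
    forall i, h (s i) = h (t i)}.
Proof.
apply: filter_forall => s; apply: filter_forall => t.
have [st|] := pselect (forall i, h (s i) = h (t i)); first exact: aeW.
move=> /existsNP[i /eqP sti].
have c_neq0 : h (t i) - h (s i) != 0 by rewrite subr_eq0 eq_sym.
pose c j := h (t j) - h (s j).
pose u := 2^-1 * \sum_(j < N) \sum_(k < d)
  (h (t j) ord0 k ^+ 2 - h (s j) ord0 k ^+ 2).
exists (Z @^-1` [set z | \sum_(j < N) linear_form (c j) (tnth z j) = u]).
split.
- exact: (measurable_funPTI Z (measurable_tuple_hyperplane c u)).
- exact: (@power_law_hyperplane _ _ _ mu (distribution P Z) mu_ac _ c u i).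
- by move=> w /= /not_implyP[/assignment_tie].
Qed.

(** Exchangeability: relabelling by [s] preserves the law of the sample and turns optimality of [s]
    into optimality of the identity. *)
Lemma optimal_assignment_equiprobable s :
  P [set w | optimal_assignment h (tnth (Z w)) s] =
  P [set w | optimal_assignment h (tnth (Z w)) 1%g].
Proof.
pose O t := [set z | optimal_assignment h (tnth z) t].
have := @power_law_perm _ _ _ _ mu (distribution P Z) ZE s (O s)
  (measurable_optimal_assignment _ _).
rewrite (_ : perm_tuple s @^-1` O s = O 1%g) => [QO|]; first exact: esym QO.
by apply/seteqP; split => z zO; apply/optimal_assignment_perm.
Qed.

Variable g : {perm 'I_N} -> measurableTypeR R.
Hypothesis eq_g : forall s t : {perm 'I_N},
  (forall i, h (s i) = h (t i)) -> g s = g t.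
Variables (sigma : Omega -> {perm 'I_N}) (gamma : {RV P >-> measurableTypeR R}).
Hypothesis sigma_opt :
  forall w, optimal_assignment h (tnth (Z w)) (sigma w).
Hypothesis gammaE : forall w, gamma w = g (sigma w).

(** [sigma] is an arbitrary selection, not assumed measurable, so the events where it takes a given
    value are avoided. Instead every optimal permutation is counted: almost surely there are as many
    as the stabilizer has elements, and all give the same value of [g]. *)
Lemma rank_law_sum B : measurable B ->
  ((#|rank_stabilizer h|%:R)%:E * distribution P gamma B =
   (\sum_(s : {perm 'I_N}) \d_(g s) B) *
   P [set w | optimal_assignment h (tnth (Z w)) 1%g])%E.
Proof.
move=> mB.
pose O s := [set w | optimal_assignment h (tnth (Z w)) s].
have mO s : measurable (O s).
  exact: (measurable_funPTI Z (measurable_optimal_assignment h s)).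
have mgB : measurable (gamma @^-1` B) by exact: measurable_funPTI.
have dg0 s : (0 <= \d_(g s) B :> \bar R)%E by exact: measure_ge0.
transitivity (\int[P]_w ((#|rank_stabilizer h|%:R)%:E *
    (\1_(gamma @^-1` B) w)%:E))%E.
  rewrite ge0_integralZl//; first by rewrite integral_indic// setIT.
  by apply/measurable_EFinP; exact: measurable_indic.
(* All events [O s] have the probability of [O 1%g], which factors out of the sum. *)
transitivity (\int[P]_w \sum_(s : {perm 'I_N})
    (\d_(g s) B * (\1_(O s) w)%:E))%E; last first.
  rewrite ge0_integral_sum//; last 2 first.
  - move=> s; apply: measurable_funeM; apply/measurable_EFinP.
    exact: measurable_indic.
  - by move=> s w _; apply: mule_ge0 => //; rewrite lee_fin.
  rewrite ge0_sume_distrl//; apply: eq_bigr => s _.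
  rewrite ge0_integralZl//.
    by rewrite integral_indic// setIT -(optimal_assignment_equiprobable s).
  by apply/measurable_EFinP; exact: measurable_indic.
apply: ae_eq_integral => //.
- apply: measurable_funeM; apply/measurable_EFinP; exact: measurable_indic.
- apply: emeasurable_sum => s; apply: measurable_funeM; apply/measurable_EFinP.
  exact: measurable_indic.
apply: filterS ae_no_assignment_tie => w noties _.
(* Any optimal [s] ties with [sigma w], hence gives the same ranks off the null set. *)
have gE s : optimal_assignment h (tnth (Z w)) s -> g s = gamma w.
  move=> opt; rewrite gammaE; apply: eq_g; apply: noties; apply/le_anti.
  by rewrite (opt (sigma w)) (sigma_opt w s).
(* The size of the stabilizer is spread as a constant sum over the optimal permutations. *)
transitivity (\sum_(s in [set t : {perm 'I_N} |
    `[< optimal_assignment h (tnth (Z w)) t >]]%SET)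
    (\1_(gamma @^-1` B) w : R)%:E)%E.
  rewrite sumEFin sumr_const (card_optimal_assignment noties (sigma_opt w)).
  by rewrite -EFinM mulr_natl.
rewrite big_mkcond/=; apply: eq_bigr => s _; rewrite inE diracE !indicE.
case: asboolP => opt.
  by rewrite (mem_set (opt : O s w)) mule1 (gE s opt); congr (_%:R%:E);
    apply/idP/idP; rewrite !inE.
by rewrite (memNset (opt : ~ O s w)) mule0.
Qed.

(** Applied to the whole space, the counting identity determines the unknown probability that the
    identity is optimal; substituting it cancels the size of the stabilizer. *)
Lemma rank_law B : measurable B ->
  distribution P gamma B = uniform_image (1%g : {perm 'I_N}) g B.
Proof.
move=> mB; set k : R := #|rank_stabilizer h|%:R.
have k_neq0 : k != 0.
  rewrite pnatr_eq0 -lt0n; apply/card_gt0P; exists 1%g.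
  by rewrite inE; apply/forallP => i; rewrite perm1.
have c_neq0 : #|{perm 'I_N}|%:R != 0 :> R.
  by rewrite pnatr_eq0 -lt0n; apply/card_gt0P; exists 1%g.
have sumE A : (\sum_(s : {perm 'I_N}) \d_(g s) A)%E =
    (\sum_(s : {perm 'I_N}) (g s \in A)%:R)%:E :> \bar R.
  by rewrite -sumEFin; apply: eq_bigr => s _; rewrite diracE.
have := rank_law_sum mB.
have := rank_law_sum (@measurableT _ (measurableTypeR R)).
rewrite -/k uniform_imageE !sumE probability_setT.
have mO1 : measurable [set w | optimal_assignment h (tnth (Z w)) 1%g].
  exact: (measurable_funPTI Z (measurable_optimal_assignment h 1%g)).
(* Probabilities are finite, so the two equations can be solved in [R]. *)
rewrite -(fineK (fin_num_measure P _ mO1)).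
rewrite -(fineK (fin_num_measure (distribution P gamma) _ mB)).
set q := fine _; set x := fine _; rewrite -!EFinM.
rewrite (eq_bigr (fun=> 1)) => [|s _]; last by rewrite in_setT.
rewrite sumr_const mulr1 => -[kE] -[kxE]; congr EFin.
by apply: (mulfI k_neq0); rewrite kxE kE; field.
Qed.

End rank_law.

(** * The law of the pooled sample *)

Lemma pooled_lshift {T : Type} {m n : nat} (x : 'I_m -> T) (y : 'I_n -> T) i :
  pooled x y (lshift n i) = x i.
Proof. by rewrite /pooled (unsplitK (inl i)). Qed.

Lemma pooled_rshift {T : Type} {m n : nat} (x : 'I_m -> T) (y : 'I_n -> T) j :
  pooled x y (rshift m j) = y j.
Proof. by rewrite /pooled (unsplitK (inr j)). Qed.

Section pooled_sample.
Context {R : realType} {disp : measure_display} {Omega : measurableType disp}.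
Context {disp1 : measure_display} {T : measurableType disp1}.
Variable P : probability Omega R.

Lemma iid_sample_tuple {m : nat} (X : 'I_m -> {RV P >-> T})
    (mu : probability T R) (A : 'I_m -> set T) :
  iid X mu -> (forall i, measurable (A i)) ->
  P (sample_tuple X @^-1` tuple_box A) = (\prod_(i < m) mu (A i))%E.
Proof.
move=> [X_indep X_law] mA.
rewrite (_ : _ @^-1` _ =
    \bigcap_(i in [set` [set: 'I_m]%SET]) (X i @^-1` A i)).
  rewrite X_indep//; apply: eq_big => [i|i _]; first by rewrite inE.
  exact: X_law.
apply/seteqP; split => w Xw i; first by have := Xw i; rewrite tnth_mktuple.
by rewrite tnth_mktuple; apply: Xw; rewrite /= inE.
Qed.

Variables m n : nat.
Variables (X : 'I_m -> {RV P >-> T}) (Y : 'I_n -> {RV P >-> T}).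

Definition pooled_tuple (w : Omega) : (m + n).-tuple T :=
  [tuple pooled (fun i => X i w) (fun j => Y j w) l | l < m + n].

Lemma measurable_pooled_tuple : measurable_fun setT pooled_tuple.
Proof.
apply/measurable_fun_tnthP => l.
have [i il|j jl] := split_ordP l.
  rewrite (_ : _ \o _ = X i); first exact: measurable_funPT.
  by apply/funext => w /=; rewrite tnth_mktuple il pooled_lshift.
rewrite (_ : _ \o _ = Y j); first exact: measurable_funPT.
by apply/funext => w /=; rewrite tnth_mktuple jl pooled_rshift.
Qed.

HB.instance Definition _ :=
  isMeasurableFun.Build _ _ _ _ pooled_tuple measurable_pooled_tuple.

(** A box splits into one box for each sample; independence of the two samples separates these, and
    independence within each sample does the rest. *)
Lemma iid_pooled_tuple (mu : probability T R) (A : 'I_(m + n) -> set T) :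
  iid X mu -> iid Y mu -> independent_samples X Y ->
  (forall l, measurable (A l)) ->
  P (pooled_tuple @^-1` tuple_box A) = (\prod_(l < m + n) mu (A l))%E.
Proof.
move=> Xmu Ymu XY mA; rewrite big_split_ord/=.
rewrite -(iid_sample_tuple Xmu)// -(iid_sample_tuple Ymu)// -XY; last 2 first.
- exact: measurable_tuple_box.
- exact: measurable_tuple_box.
congr (P _); apply/seteqP; split => [w XYw|w [/= Xw Yw] l].
  split => k.
    by have := XYw (lshift n k); rewrite !tnth_mktuple pooled_lshift.
  by have := XYw (rshift m k); rewrite !tnth_mktuple pooled_rshift.
rewrite tnth_mktuple; have [i ->|j ->] := split_ordP l.
  by rewrite pooled_lshift; have := Xw i; rewrite tnth_mktuple.
by rewrite pooled_rshift; have := Yw j; rewrite tnth_mktuple.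
Qed.

End pooled_sample.

Theorem proposition4p1 (R : realType) (d m n : nat)
    (m_ge1 : (1 <= m)%N) (n_ge1 : (1 <= n)%N)
    (h : 'I_(m + n) -> 'rV[R]_d)
    (nu : probability 'rV[R]_d R) (nu_ac : abs_continuous nu)
    (J : 'rV[R]_d -> 'rV[R]_d) (J_inj : injective J)
    (J_cont : ae_continuous J)
    (K : 'rV[R]_d -> 'rV[R]_d -> R) (K_sym : symmetric_kernel K)
    (K_nnd : nonneg_definite K) (K_cont : ae_continuous2 K) :
  exists L : probability (measurableTypeR R) R,
  forall (mu1 mu2 : probability 'rV[R]_d R),
    mu1 = mu2 -> abs_continuous mu1 ->
  forall (disp : measure_display) (Omega : measurableType disp)
    (P : probability Omega R)
    (X : 'I_m -> {RV P >-> 'rV[R]_d}) (Y : 'I_n -> {RV P >-> 'rV[R]_d}),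
    iid X mu1 -> iid Y mu2 -> independent_samples X Y ->
  forall sigma : Omega -> {perm 'I_(m + n)},
    (forall w, optimal_assignment h
                 (pooled (fun i => X i w) (fun j => Y j w)) (sigma w)) ->
  forall gamma : {RV P >-> measurableTypeR R},
    (forall w, gamma w = rank_statistic h J K (sigma w)) ->
  forall B : set (measurableTypeR R), measurable B ->
    distribution P gamma B = L B.
Proof.
(* This law involves only [h], [J] and [K], so it can be chosen before [mu1]. *)
exists (@uniform_image R _ (measurableTypeR R) {perm 'I_(m + n)} 1%g
  (rank_statistic h J K)).
move=> mu1 _ <- mu1_ac disp Omega P X Y Xmu Ymu XY sigma sigma_opt gamma gammaE.
have poolE w : tnth (pooled_tuple X Y w) =
    pooled (fun i => X i w) (fun j => Y j w).
  by apply/funext => l; rewrite tnth_mktuple.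
apply: (rank_law (h := h) (Z := pooled_tuple X Y) mu1_ac).
- by move=> A mA; exact: iid_pooled_tuple.
(* The statistic reads [s] only through the vectors [h (s i)]. *)
- move=> s t st; rewrite /rank_statistic.
  by congr kernel_two_sample; apply/funext => i; rewrite st.
- by move=> w; rewrite poolE; exact: sigma_opt.
- exact: gammaE.
Qed.
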